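(* For every integer $\ell \ge 3$ and every integer $r\ge 4$, we have \[ |\mathrm{Forb}_r(n, C^r_{\ell})| < 2^{2r^2\ell\, n^{r-1}\log\log n} \] for all sufficiently large $n$.
   Context: An $r$-uniform hypergraph ($r$-graph) on a vertex set $X$ is a collection of $r$-element subsets of $X$ (edges). For $\ell\ge 3$, the $r$-uniform loose cycle $C_\ell^r$ is the $r$-graph on $\ell(r-1)$ vertices whose vertices can be ordered cyclically so that the edges are sets of $r$ consecutive vertices and every two consecutive edges share exactly one vertex. An $r$-graph is $H$-free if it contains no copy of $H$ as a subgraph. $\mathrm{Forb}_r(n,H)$ denotes the set of all $H$-free $r$-graphs with vertex set $[n]=\{1,\dots,n\}$. Logarithms are base $2$. *)

(* Defs.v *)
From mathcomp Require Import all_boot all_order all_algebra.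
From mathcomp Require Import all_classical all_reals all_analysis.

Set Implicit Arguments.
Unset Strict Implicit.
Unset Printing Implicit Defensive.

Import Order.TTheory GRing.Theory Num.Theory.

(* A hypergraph on the vertex set T is represented by its set of edges. *)
Definition uniform (T : finType) (r : nat) (G : {set {set T}}) : bool :=
  [forall e in G, #|e| == r].

(* Copies are not required to be induced. *)
Definition contains_copy (W T : finType) (H : {set {set W}})
    (G : {set {set T}}) : bool :=
  [exists f : {ffun W -> T},
    injectiveb f && [forall e in H, (f @: e) \in G]].

(* The vertices 0, ..., l * (r - 1) - 1 are in their natural cyclic order; the
   i-th edge consists of the r consecutive vertices starting at i * (r - 1), so
   its last vertex is the first vertex of the next edge. *)
Definition loose_cycle_edge (r l : nat) (i : 'I_l) : {set 'I_(l * r.-1)} :=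
  [set v : 'I_(l * r.-1) |
    [exists j : 'I_r, val v == (i * r.-1 + j) %% (l * r.-1)]].

Definition loose_cycle (r l : nat) : {set {set 'I_(l * r.-1)}} :=
  [set loose_cycle_edge r i | i : 'I_l].

(* The vertex set {1, ..., n} is represented by 'I_n = {0, ..., n - 1}. *)
Definition Forb (r n : nat) (W : finType) (H : {set {set W}}) :
    {set {set {set 'I_n}}} :=
  [set G : {set {set 'I_n}} | uniform r G && ~~ contains_copy H G].

Definition log2 (R : realType) (x : R) : R := (ln x / ln 2)%R.

(* Main.v *)
Require Import Defs.
From mathcomp Require Import all_boot.

Set Implicit Arguments.
Unset Strict Implicit.
Unset Printing Implicit Defensive.

(** If every (r-1)-set lying in an edge of a nonempty r-graph has codegree at
    least l * r, then the 2-shadow contains an l-cycle, whose pairs extend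
    greedily to a loose cycle.  Hence an r-graph without a loose cycle is
    degenerate: it is covered by at most l * r partial colourings of the
    (r-1)-sets by vertices, an edge being an (r-1)-set together with its colour.
    To count such colourings, cut [n] into blocks of size s ~ log n.  Inside any
    r-1 blocks only O(s ^ (r-2)) colours occur: otherwise (r-1)-sets
    representing the colours contain a loose cycle by degeneracy in uniformity
    r-1 >= 3, and adding the distinct colours to its edges yields a loose cycle
    in the r-graph.  Choosing the palettes costs 2 ^ O(n ^ (r-1)) and choosing
    the colours within the palettes costs O(s ^ (r-2)) ^ (n ^ (r-1)). *)

Lemma card_bigcup_le (I T : finType) (P : pred I) (F : I -> {set T}) c :
  (forall i, P i -> #|F i| <= c) -> #|\bigcup_(i | P i) F i| <= #|P| * c.
Proof.
move=> Fc; rewrite -sum_nat_const.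
apply: (big_ind2 (fun A n => #|A : {set T}| <= n)) => [|A a B b Aa Bb|//].
  by rewrite cards0.
by apply: leq_trans (leq_card_setU _ _) _; apply: leq_add.
Qed.

(** [x i] and [x (ordS i)] are the vertices that the i-th edge shares with its
    neighbours, [P i] the q others; edges have q + 2 vertices. *)
Definition has_loose_cycle (T : finType) (q l : nat) (G : {set {set T}}) :=
  exists (x : 'I_l -> T) (P : 'I_l -> {set T}),
    [/\ injective x,
        forall i, #|P i| = q,
        forall i j, x i \notin P j,
        forall i j, i != j -> [disjoint P i & P j]
      & forall i, x i |: (x (ordS i) |: P i) \in G].

(** The edges are meant to be of one size; for [w] in [e :\ v] the set
    [w |: (e :\ v)] is then too small to be an edge. *)
Definition full (T : finType) (d : nat) (G : {set {set T}}) :=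
  forall (e : {set T}) v, e \in G -> v \in e ->
    d <= #|[set w | w |: (e :\ v) \in G]|.

Lemma has_loose_cycleS (T : finType) q l (G H : {set {set T}}) :
  G \subset H -> has_loose_cycle q l G -> has_loose_cycle q l H.
Proof.
move=> /subsetP sGH [x [P [? ? ? ? xG]]]; exists x, P; split=> // i.
exact/sGH/xG.
Qed.

(** * Loose cycles from large codegrees *)

Section Full.
Variables (T : finType) (q d : nat) (G : {set {set T}}).
Hypotheses (uG : forall e, e \in G -> #|e| = q.+3) (fG : full d G).

(** At least [d] vertices complete [e :\ v], so one of them avoids [B]; it lies outside [e :\ v]
    because the completed set has the size of an edge. *)
Lemma full_fresh (e B : {set T}) v :
    e \in G -> v \in e -> #|B| < d ->
  exists w, [/\ w \notin B, w \notin e :\ v & w |: (e :\ v) \in G].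
Proof.
move=> eG ve Bd; have := leq_trans Bd (fG eG ve).
set W := [set w | _] => BW.
have /subsetPn[w wW wB] : ~~ (W \subset B).
  by apply: contraL BW => /subset_leq_card; rewrite -leqNgt.
move: wW; rewrite inE => wG; exists w; split=> //; apply/negP => we.
have : w |: (e :\ v) = e :\ v by apply/setUidPr; rewrite sub1set.
move: (uG wG) => /[swap] ->; have := cardsD1 v e; rewrite ve (uG eG) add1n => -[<-].
by move/n_Sn.
Qed.

Definition shadow x y := (x != y) && [exists e in G, [&& x \in e & y \in e]].

Lemma shadow_triangle : G != set0 ->
  exists s, [/\ uniq s, size s = 3 & cycle shadow s].
Proof.
move=> /set0Pn[e eG]; have := uG eG; rewrite cardE.
move: (enum_uniq e) (mem_enum e).
case: (enum e) => [//|x [//|y [//|z s]]] /= /and4P[].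
rewrite !inE !negb_or => /and3P[xy xz _] /andP[yz _] _ _ es _.
exists [:: x; y; z]; split=> //=; first by rewrite !inE negb_or xy xz yz.
have [xe ye ze] : [/\ x \in e, y \in e & z \in e].
  by rewrite -!es !inE !eqxx !orbT.
rewrite /shadow xy yz eq_sym xz /= andbT.
by apply/and3P; split; apply/existsP; exists e; rewrite eG ?xe ?ye ?ze.
Qed.

(** Induction on [l] from a triangle inside one edge: in an edge through consecutive vertices [x],
    [y], a third vertex is exchanged for some [w] off the cycle, and [w] is inserted between [x] and
    [y]. *)
Lemma shadow_cycle l : 3 <= l -> l <= d -> G != set0 ->
  exists s, [/\ uniq s, size s = l & cycle shadow s].
Proof.
elim: l => // l IH; rewrite leq_eqVlt => /predU1P[<- _|l3 ld] G0.
  exact: shadow_triangle.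
have [s [us ss]] := IH l3 (ltnW ld) G0.
case: s us ss l3 => [_ <- //|x [_ <- //|y s]] us ss l3 /=.
case/andP=> /andP[xy /existsP[e /and3P[eG xe ye]]] ys.
have [v ve /andP[vx vy]] : exists2 v, v \in e & (v != x) && (v != y).
  have /subsetPn[v ve] : ~~ (e \subset [set x; y]).
    by apply/negP => /subset_leq_card; rewrite uG // cards2 xy.
  by rewrite !inE negb_or; exists v.
have Bd : #|[set z in x :: y :: s]| < d by rewrite cardsE (card_uniqP us) ss.
have [w [wB wev wG]] := full_fresh eG ve Bd.
move: wB; rewrite inE => ws.
exists (x :: w :: y :: s); split.
- move: us ws; rewrite /= !inE !negb_or => /and3P[/andP[-> ->] -> ->].
  by case/and3P=> wx -> ->; rewrite eq_sym wx.
- by rewrite -ss.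
move: ws; rewrite !inE !negb_or => /and3P[wx wy _].
rewrite /= ys andbT /shadow eq_sym wx wy /=.
apply/andP; split; apply/existsP; exists (w |: (e :\ v)).
all: by rewrite wG !inE eqxx /= ?xe ?ye ![_ == v]eq_sym ?vx ?vy ?orbT.
Qed.

(* Exchanging the private vertices that lie in B for fresh ones, one at a
   time, keeps the pair x, y. *)
Lemma shadow_private x y (B : {set T}) : shadow x y -> #|B| < d ->
  exists P : {set T}, [/\ #|P| = q.+1, x \notin P, y \notin P,
    [disjoint P & B] & x |: (y |: P) \in G].
Proof.
case/andP=> xy /existsP ex Bd.
pose m e := #|(e :\ x :\ y) :&: B|.
have [n] : exists n, exists2 e, [&& e \in G, x \in e & y \in e] & m e = n.
  by case: ex => e ?; exists (m e), e.
elim: n => [|n IH] [e /and3P[eG xe ye] me].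
  have yex : y \in e :\ x by rewrite !inE eq_sym xy.
  exists (e :\ x :\ y); split.
  - have := uG eG; rewrite (cardsD1 x) xe (cardsD1 y) yex.
    by case.
  - by rewrite !inE eqxx andbF.
  - by rewrite !inE eqxx.
  - by rewrite -setI_eq0 -cards_eq0 -/(m e) me.
  - by rewrite (setD1K yex) (setD1K xe).
have /set0Pn[v] : (e :\ x :\ y) :&: B != set0 by rewrite -card_gt0 -/(m e) me.
rewrite !inE => /andP[/and3P[vy vx ve] vB].
have [w [wB wev wG]] := full_fresh eG ve Bd.
apply: IH; exists (w |: (e :\ v)).
  by rewrite wG !inE xe ye ![_ == v]eq_sym vx vy !orbT.
apply/eqP; rewrite -eqSS -me /m.
rewrite [X in _ == X](cardsD1 v) !inE vy vx ve vB add1n eqSS; apply/eqP/eq_card => z.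
rewrite !inE; case: (eqVneq z w) => [->|_] /=; last by do !case: (_ == _).
by rewrite (negPf wB) !andbF.
Qed.

Lemma full_has_loose_cycle l : 3 <= l -> l * q.+3 <= d -> G != set0 ->
  has_loose_cycle q.+1 l G.
Proof.
move=> l3 ld G0.
have [s [us ss cs]] : exists s, [/\ uniq s, size s = l & cycle shadow s].
  by apply: shadow_cycle => //; apply: leq_trans ld; rewrite leq_pmulr.
have x0 : T by case: (s) ss l3 => [<-|].
pose x (i : 'I_l) := nth x0 s i.
have xinj : injective x.
  move=> i j /eqP; rewrite nth_uniq ?ss // => /eqP; exact: val_inj.
have xsh i : shadow (x i) (x (ordS i)).
  rewrite /x /=; move: (nat_of_ord i) (ltn_ord i) => {}i; rewrite -ss in l3 *.
  case: (s) cs l3 => [//|y t] /= cs _ il.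
  have := pathP x0 cs i; rewrite size_rcons -rcons_cons !nth_rcons /= il => /(_ isT).
  (* The last index gives the closing pair, where [ordS] wraps around to 0. *)
  move: il; rewrite ltnS leq_eqVlt => /predU1P[->|it].
    by rewrite ltnn eqxx modnn.
  by rewrite it modn_small.
pose J := [set x i | i : 'I_l].
have cJ : #|J| = l by rewrite card_imset // card_ord.
have [P [P1 P2 P3 P4]] : exists P : 'I_l -> {set T}, [/\
    forall i, #|P i| = q.+1, forall i j, x i \notin P j,
    forall i j : 'I_l, j < i -> [disjoint P i & P j] &
    forall i, x i |: (x (ordS i) |: P i) \in G].
  (* Private sets are chosen one after another, each avoiding all joints and the earlier private
     sets. *)
  pose Q m (P : 'I_l -> {set T}) := forall i : 'I_l, i < m -> [/\
    #|P i| = q.+1, forall j, x j \notin P i,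
    forall j : 'I_l, j < i -> [disjoint P i & P j] &
    x i |: (x (ordS i) |: P i) \in G].
  suff /(_ l (leqnn l))[P QP] : forall m, m <= l -> exists P, Q m P.
    exists P; split=> [i|i j|i j|i]; first 1 last.
    - by have [] := QP j (ltn_ord j).
    - by have [_ _ + _] := QP i (ltn_ord i); apply.
    - by have [] := QP i (ltn_ord i).
    - by have [] := QP i (ltn_ord i).
  elim=> [|m IH] ml; first by exists (fun=> set0).
  have [P QP] := IH (ltnW ml).
  pose i0 := Ordinal ml.
  pose B := J :|: \bigcup_(j : 'I_l | j < m) P j.
  have Bd : #|B| < d.
    apply: leq_trans ld; apply: leq_ltn_trans (leq_card_setU _ _) _; rewrite cJ.
    have /card_bigcup_le PB (j : 'I_l) : j < m -> #|P j| <= q.+1 by move=> /QP[->].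
    (* Joints and private sets use at most [l * q.+2] vertices, fewer than the codegree bound. *)
    apply: (@leq_ltn_trans (l + l * q.+1)).
      rewrite leq_add2l (leq_trans PB) // leq_mul2r.
        by rewrite (leq_trans (max_card _)) ?orbT ?card_ord.
    by rewrite -mulnS ltn_pmul2l // (leq_trans _ l3).
  have [Pm [cPm _ _ dPm PmG]] := shadow_private (xsh i0) Bd.
  exists (fun i => if i == i0 then Pm else P i) => i; rewrite ltnS.
  have neq (j : 'I_l) : j < m -> (j == i0) = false.
    by move=> jm; apply/negbTE; rewrite -val_eqE /= neq_ltn jm.
  rewrite leq_eqVlt => /predU1P[im|im].
    have -> : i = i0 by exact: val_inj.
    rewrite eqxx; split=> // j => [|/= jm].
      by apply/negP => xj; have := disjointFr dPm xj; rewrite inE imset_f.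
    rewrite neq //; apply: disjointWr dPm.
    by apply: subset_trans (subsetUr _ _); apply: bigcup_sup.
  rewrite neq //; have [? ? h ?] := QP i im; split=> // j ji.
  by rewrite neq ?h // (ltn_trans ji).
exists x, P; split=> // i j; rewrite neq_ltn => /orP[] ij; last exact: P3.
by rewrite disjoint_sym P3.
Qed.
End Full.

(** * Degenerate hypergraphs and their colourings *)

Lemma bin_leq_exp n k : 'C(n, k) <= n ^ k.
Proof.
rewrite (leq_trans (leq_pmulr _ (fact_gt0 k))) // bin_ffact.
rewrite ffact_prod -[k in _ ^ k]card_ord -prod_nat_const.
by apply: leq_prod => i _; apply: leq_subr.
Qed.

Section Degenerate.
Variable T : finType.
Implicit Types (e S : {set T}) (G H : {set {set T}}).

(** Peeling: while edges remain, some edge minus a vertex has codegree below [d]; its completions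
    are recorded in [N] and all edges they form are removed. *)
Lemma degenerate_cover r d G : (forall e, e \in G -> #|e| = r) ->
    (forall H, H \subset G -> full d H -> H = set0) ->
  exists N : {set T} -> {set T}, [/\ forall S, #|N S| <= d,
    forall S v, v \in N S -> [/\ #|S| = r.-1, v \notin S & v |: S \in G]
    & forall e, e \in G -> exists S v, v \in N S /\ e = v |: S].
Proof.
have [n] := ubnP #|G|; elim: n G => // n IH G Gn uG degG.
pose low (p : {set T} * T) := [&& p.1 \in G, p.2 \in p.1 &
  #|[set w | w |: (p.1 :\ p.2) \in G]| < d].
case: (pickP low) => [[e v] /and3P[/= eG ve ltd]|fullG]; last first.
  have -> : G = set0.
    apply: degG => // e v eG ve; rewrite leqNgt.
    by have := fullG (e, v); rewrite /low /= eG ve /= => ->.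
  exists (fun=> set0); split=> [S|S w|e]; by rewrite ?cards0 ?inE.
pose S0 := e :\ v; pose N0 := [set w | w |: S0 \in G].
pose G' := G :\: [set w |: S0 | w in N0].
have sG : G' \subset G by exact: subsetDl.
have eN0 : e \in [set w |: S0 | w in N0].
  by apply/imsetP; exists v; rewrite ?inE /S0 setD1K.
have [||H sH|N [N1 N2 N3]] := IH G'.
- apply: leq_trans (_ : #|G'| < #|G|) Gn; apply: proper_card.
  by apply/properP; split=> //; exists e; rewrite // inE eN0.
- by move=> f /(subsetP sG)/uG.
- by apply: degG; apply: subset_trans sG.
have cS0 : #|S0| = r.-1 by rewrite -(uG e eG) (cardsD1 v e) ve.
exists (fun S => if S == S0 then N0 else N S); split.
- by move=> S; case: eqP => // _; apply: ltnW.
- move=> S w; case: eqP => [->|_ /N2[-> -> /(subsetP sG)]//].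
  rewrite inE => wG; split=> //; apply/negP => wS.
  have := uG _ wG; rewrite (setUidPr _) ?sub1set // cS0.
  have := uG e eG; rewrite (cardsD1 v e) ve => <-; exact: n_Sn.
move=> f fG; have [|fN0] := boolP (f \in [set w |: S0 | w in N0]).
  by case/imsetP=> w wN0 ->; exists S0, w; rewrite eqxx.
have fG' : f \in G' by rewrite inE fN0.
have [S [w [wN fE]]] := N3 _ fG'; exists S, w; split=> //.
(* Overwriting the recursive value at [S0] loses nothing: every edge of the form [w |: S0] has been
   removed from [G']. *)
case: eqP => // SE; case/negP: fN0.
by apply/imsetP; exists w; rewrite ?inE -?SE -?fE.
Qed.

Lemma card_degenerate_le r d G (V : {set T}) :
    (forall e, e \in G -> #|e| = r) -> (forall e, e \in G -> e \subset V) ->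
    (forall H, H \subset G -> full d H -> H = set0) ->
  #|G| <= d * #|V| ^ r.-1.
Proof.
move=> uG GV /(degenerate_cover uG)[N [N1 N2 N3]].
pose D := [set S : {set T} | (S \subset V) && (#|S| == r.-1)].
have sub : G \subset \bigcup_(S in D) [set v |: S | v in N S].
  apply/subsetP => e eG; have [S [v [vN eE]]] := N3 e eG.
  apply/bigcupP; exists S; last by apply/imsetP; exists v.
  have [cS _ _] := N2 _ _ vN; rewrite inE cS eqxx andbT.
  by apply: subset_trans (GV _ eG); rewrite eE subsetUr.
apply: leq_trans (subset_leq_card sub) _.
apply: leq_trans (card_bigcup_le (c := d) _) _ => [S _|].
  by apply: leq_trans (N1 S); apply: leq_imset_card.
by rewrite mulnC leq_mul2l cards_draws bin_leq_exp orbT.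
Qed.

Lemma no_loose_cycle_degenerate q l G H : 3 <= l ->
    (forall e, e \in G -> #|e| = q.+3) -> ~ has_loose_cycle q.+1 l G ->
  H \subset G -> full (l * q.+3) H -> H = set0.
Proof.
move=> l3 uG noG sH fH; apply/eqP; apply: contra_notT noG => H0.
apply: (has_loose_cycleS sH); apply: (full_has_loose_cycle _ fH) => //.
by move=> e /(subsetP sH)/uG.
Qed.

(* One edge per colour gives a hypergraph whose loose cycles expand, by adding
   the colours to the edges, to loose cycles of G. *)
Lemma few_colours q l G (V : {set T}) (chi : {set T} -> option T) : 3 <= l ->
    ~ has_loose_cycle q.+2 l G ->
    (forall S v, chi S = Some v -> [/\ #|S| = q.+3, v \notin S & v |: S \in G]) ->
  #|[set chi S | S : {set T} & S \subset V]| <=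
    (1 + #|V| + l * q.+3 * #|V| ^ q.+2).
Proof.
move=> l3 noG chiP.
(* Colours outside [V] are automatically new vertices for edges inside [V]; [None] and the colours
   in [V] account for the summand [1 + #|V|]. *)
pose C := [set v in ~: V | [exists S : {set T}, (S \subset V) && (chi S == Some v)]].
pose rep v := odflt set0 [pick S : {set T} | (S \subset V) && (chi S == Some v)].
have repP v : v \in C -> rep v \subset V /\ chi (rep v) = Some v.
  rewrite !inE => /andP[_ /existsP ex]; rewrite /rep.
  by case: pickP => [S /andP[? /eqP]|/= no] //; case: ex => S; rewrite no.
pose H := [set rep v | v in C].
have HP e : e \in H -> exists2 v, v \in C & [/\ e \subset V, chi e = Some v & e = rep v].
  by case/imsetP => v vC ->; exists v => //; case: (repP v vC).
have cH : #|H| = #|C|.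
  apply: card_in_imset => u v /repP[_ uE] /repP[_ vE] uv.
  by move: uE; rewrite uv vE => -[].
have uH e : e \in H -> #|e| = q.+3.
  by case/HP => v _ [_ /chiP[]].
have sub : [set chi S | S : {set T} & S \subset V] \subset
    None |: ([set Some v | v in V] :|: [set Some v | v in C]).
  apply/subsetP => c /imsetP[S]; rewrite inE => SV ->{c}.
  case cS: (chi S) => [v|]; last by rewrite !inE.
  rewrite !inE /=; apply/orP.
  have [vV|vV] := boolP (v \in V); [left|right]; apply: imset_f => //.
  by rewrite !inE vV; apply/existsP; exists S; rewrite SV cS eqxx.
apply: leq_trans (subset_leq_card sub) _.
rewrite cardsU1 -addnA leq_add ?leq_b1 //.
apply: leq_trans (leq_card_setU _ _) _; rewrite leq_add ?leq_imset_card //.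
apply: leq_trans (leq_imset_card _ _) _; rewrite -cH.
apply: (card_degenerate_le uH) => [e /HP[v _ []] //|K].
apply: (no_loose_cycle_degenerate l3 uH) => -[x [P [xinj cP xP dP eH]]].
pose e i := x i |: (x (ordS i) |: P i); apply: noG.
have /fin_all_exists[u uP] i : exists v, v \in C /\ 
    [/\ e i \subset V, chi (e i) = Some v & e i = rep v].
  by have [v ? ?] := HP _ (eH i); exists v.
have eV i j w : w \in e i -> w != u j.
  case: (uP i) => _ [/subsetP eiV _ _] /eiV wV.
  by apply: contraTneq wV => ->; case: (uP j); rewrite !inE => /andP[].
(* Equal colours have the same representative, whereas the nonempty [P i] meets no edge of the cycle
   but the [i]-th. *)
have uinj : injective u.
  move=> i j uij; apply/eqP; apply: contraT => ij.
  have /card_gt0P[w wi] : 0 < #|P i| by rewrite cP.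
  have : w \in e j.
    have [_ [_ _ ->]] := uP j; rewrite -uij; have [_ [_ _ <-]] := uP i.
    by rewrite !inE wi !orbT.
  rewrite !inE (disjointFr (dP _ _ ij) wi) orbF => /orP[] /eqP wE.
    by have := xP j i; rewrite -wE wi.
  by have := xP (ordS j) i; rewrite -wE wi.
have ue i j : u i \notin e j by apply/negP => /(eV _ i); rewrite eqxx.
have uPn i j : u i \notin P j by apply: contra (ue i j) => h; rewrite !inE h !orbT.
exists x, (fun i => u i |: P i); split=> //.
- by move=> i; rewrite cardsU1 uPn cP.
- move=> i j; rewrite !inE negb_or xP andbT.
  by apply: (eV i); rewrite !inE eqxx.
- move=> i j ij; rewrite -setI_eq0; apply/eqP/setP => w; rewrite !inE.
  apply/negbTE/negP => /andP[/orP[/eqP->|wi]] /orP[/eqP wj|wj].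
  + by move/uinj: wj ij => ->; rewrite eqxx.
  + by rewrite (negPf (uPn _ _)) in wj.
  + by rewrite wj (negPf (uPn _ _)) in wi.
  + by rewrite (disjointFr (dP _ _ ij) wi) in wj.
move=> i; have [_ [_ /chiP[_ _ +] _]] := uP i.
by rewrite (setUCA [set x (ordS i)]) (setUCA [set x i]).
Qed.
End Degenerate.

(** Each list [L i] is a joint followed by its private vertices. Their concatenation is the cyclic
    order: [v] goes to position [v %% q.+1] of list [v %/ q.+1]. *)
Lemma has_loose_cycle_copy (T : finType) q l (G : {set {set T}}) : 0 < l ->
  has_loose_cycle q l G -> contains_copy (loose_cycle q.+2 l) G.
Proof.
move=> l0 [x [P [xinj cP xP dP xG]]].
pose L i := x i :: enum (P i).
have sL i : size (L i) = q.+1 by rewrite /= -cardE cP.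
have memL i w : (w \in L i) = (w \in x i |: P i) by rewrite !inE mem_enum.
have uL i : uniq (L i) by rewrite /= mem_enum xP enum_uniq.
have disjL i j w : w \in L i -> w \in L j -> i = j.
  rewrite !memL => wi wj; apply/eqP; apply: contraLR wj => ij.
  move: wi; rewrite !inE => /orP[/eqP ->|wi].
    by rewrite inj_eq // negb_or ij xP.
  rewrite (disjointFr (dP _ _ ij) wi) orbF; apply: contraTneq wi => ->.
  exact: xP.
have blt (v : 'I_(l * q.+1)) : v %/ q.+1 < l by rewrite ltn_divLR // ltn_ord.
pose b v := Ordinal (blt v).
pose f v := nth (x (b v)) (L (b v)) (v %% q.+1).
have fL v : f v \in L (b v) by rewrite mem_nth // sL ltn_mod.
have fE (v : 'I_(l * q.+1)) (i : 'I_l) j : j < q.+1 -> val v = i * q.+1 + j ->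
    f v = nth (x i) (L i) j.
  move=> jq vE; have bi : b v = i.
    by apply: val_inj; rewrite /= vE divnMDl // divn_small // addn0.
  by rewrite /f bi vE modnMDl modn_small.
have vlt (i : 'I_l) j : j < q.+1 -> i * q.+1 + j < l * q.+1.
  move=> jq; apply: (@leq_trans (i.+1 * q.+1)); last by rewrite leq_mul2r ltn_ord orbT.
  by rewrite mulSn addnC ltn_add2r.
have joint (i : 'I_l) : (i * q.+1 + q.+1) %% (l * q.+1) = ordS i * q.+1.
  by rewrite -[X in _ + X]mul1n -mulnDl -muln_modl addn1.
apply/existsP; exists [ffun v => f v]; apply/andP; split.
  apply/injectiveP => u v; rewrite !ffunE => uv.
  have bE : b u = b v by apply: disjL (fL u) _; rewrite uv.
  move: uv; rewrite /f bE => /eqP; rewrite nth_uniq ?sL ?ltn_mod // => /eqP mE.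
  apply: val_inj; rewrite /= (divn_eq u q.+1) (divn_eq v q.+1) mE.
  by have /= -> := congr1 val bE.
apply/forall_inP => _ /imsetP[i _ ->].
suff -> : [ffun v => f v] @: loose_cycle_edge q.+2 i = x i |: (x (ordS i) |: P i).
  exact: xG.
apply/setP => w; rewrite setUCA in_setU1 -memL.
apply/imsetP/orP => [[v + ->]|].
  rewrite inE ffunE => /existsP[[j jq] /= /eqP vE].
  (* The last position [j = q.+1] of an edge is the head of the next list, by [joint] also across
     the wrap-around. *)
  move: jq; rewrite ltnS leq_eqVlt => /predU1P[jE|jq].
    left; rewrite (fE v (ordS i) 0) //=.
    by rewrite /= vE jE joint addn0.
  right; rewrite (fE v i j) ?mem_nth ?sL //.
  by rewrite /= vE modn_small // vlt.
case=> [/eqP ->|/(nthP (x i))[j]].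
  have jq := vlt (ordS i) 0 isT; exists (Ordinal jq).
    by rewrite inE; apply/existsP; exists ord_max; rewrite /= joint addn0.
  by rewrite ffunE (fE _ (ordS i) 0).
rewrite sL => jq <-; exists (Ordinal (vlt i j jq)); last by rewrite ffunE (fE _ i j).
rewrite inE; apply/existsP; exists (widen_ord (leqnSn _) (Ordinal jq)).
by rewrite /= modn_small // vlt.
Qed.

(** The bound of [few_colours] for a union of [q.+3] blocks of size [s]. *)
Definition palette_size q l s := (q.+3 * s + l * q.+3 * (q.+3 * s) ^ q.+2).+1.

(** * Encoding by palettes and indices *)

Section Counting.
Variables (T B : finType) (q l s : nat) (blk : T -> B).
Hypotheses (l3 : 3 <= l) (blk_le : forall b, #|[set v | blk v == b]| <= s).
Local Notation c := (palette_size q l s).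
Local Notation d := (l * q.+4).

Let tupleT : finType := {ffun 'I_q.+3 -> T}.
Let tupleB : finType := {ffun 'I_q.+3 -> B}.
Let range (t : tupleT) := [set t i | i : 'I_q.+3].
Let blocks (t : tupleT) : tupleB := [ffun i => blk (t i)].

(** Colourings of (q+3)-sets are stored on (q+3)-tuples, which makes the number
    of codes an exact product of powers. *)
Definition code : finType :=
  {ffun 'I_d -> {ffun tupleB -> {ffun 'I_c -> option T}} * {ffun tupleT -> 'I_c}}.

Definition colour (p : code) j t := (p j).1 (blocks t) ((p j).2 t).

Definition decode (p : code) : {set {set T}} :=
  [set e | [exists j, exists t, exists v,
     (colour p j t == Some v) && (e == v |: range t)]].

Lemma blocks_colours_le G (chi : {set T} -> option T) (b : tupleB) :
    ~ has_loose_cycle q.+2 l G ->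
    (forall S v, chi S = Some v -> [/\ #|S| = q.+3, v \notin S & v |: S \in G]) ->
  #|[set chi (range t) | t : tupleT & blocks t == b]| <= c.
Proof.
move=> noG chiP; pose V := \bigcup_i [set v | blk v == b i].
have cV : #|V| <= q.+3 * s.
  apply: leq_trans (card_bigcup_le (c := s) _) _ => [i _|]; first exact: blk_le.
  by rewrite leq_mul2r [#|_|]card_ord leqnn orbT.
apply: leq_trans (subset_leq_card (_ : _ \subset [set chi S | S : {set T} & S \subset V])) _.
  apply/subsetP => a /imsetP[t]; rewrite inE => /eqP tb ->{a}.
  apply: imset_f; rewrite inE; apply/subsetP => v /imsetP[i _ ->].
  by apply/bigcupP; exists i; rewrite // inE -tb ffunE.
apply: leq_trans (few_colours V l3 noG chiP) _.
by rewrite add1n addSn ltnS leq_add // leq_mul2l leq_exp2r // cV orbT.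
Qed.

(** The palette of a block tuple lists the colours occurring there, and a vertex tuple stores the
    position of its colour in that list, which fits into ['I_c] by [blocks_colours_le]. *)
Lemma decode_onto (G : {set {set T}}) : (forall e, e \in G -> #|e| = q.+4) ->
  ~ has_loose_cycle q.+2 l G -> exists p, decode p = G.
Proof.
move=> uG noG.
have [N [N1 N2 N3]] :=
  degenerate_cover uG (fun H => @no_loose_cycle_degenerate T q.+1 l G H l3 uG noG).
(* The [j]-th colour of [S] is the [j]-th element of [N S]; past the end, the default [None] leaves
   [S] uncoloured. *)
pose chi j S := nth None [seq Some v | v <- enum (N S)] j.
have chiP j S v : chi j S = Some v -> [/\ #|S| = q.+3, v \notin S & v |: S \in G].
  move=> chiE; apply: N2; rewrite -mem_enum -(mem_map Some_inj) -chiE mem_nth //.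
  by rewrite ltnNge; apply/negP => le; move: chiE; rewrite /chi nth_default.
pose C j b := [set chi j (range t) | t : tupleT & blocks t == b].
have cC j b : #|C j b| <= c by exact: blocks_colours_le (chiP j).
pose pal j : {ffun tupleB -> {ffun 'I_c -> option T}} :=
  [ffun b => [ffun i : 'I_c => nth None (enum (C j b)) i]].
pose idx j : {ffun tupleT -> 'I_c} :=
  [ffun t => inord (index (chi j (range t)) (enum (C j (blocks t))))].
pose p : code := [ffun j : 'I_d => (pal j, idx j)].
have pE j t : colour p j t = chi j (range t).
  have tC : chi j (range t) \in enum (C j (blocks t)).
    by rewrite mem_enum; apply: imset_f; rewrite inE.
  rewrite /colour ffunE /pal /idx /= !ffunE inordK ?nth_index //.
  by rewrite (leq_trans _ (cC j (blocks t))) // cardE index_mem.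
exists p; apply/setP => e; rewrite inE; apply/existsP/idP => [[j]|/N3[S [v [vN ->]]]].
  case/existsP=> t /existsP[v /andP[/eqP + /eqP ->]].
  by rewrite pE => /chiP[].
have [cS _ _] := N2 _ _ vN.
have jd : index v (enum (N S)) < d.
  by apply: leq_trans (N1 S); rewrite cardE index_mem mem_enum.
pose t : tupleT := [ffun i => enum_val (cast_ord (esym cS) i)].
have tS : range t = S.
  apply/setP => w; apply/imsetP/idP => [[i _ ->]|wS].
    by rewrite ffunE enum_valP.
  exists (cast_ord cS (enum_rank_in wS w)) => //.
  by rewrite ffunE cast_ordK enum_rankK_in.
exists (Ordinal jd); apply/existsP; exists t; apply/existsP; exists v.
rewrite pE tS eqxx andbT /chi (nth_map v) ?nth_index ?mem_enum //.
by rewrite index_mem mem_enum.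
Qed.

Lemma card_no_loose_cycle_le (F : {set {set {set T}}}) :
    (forall G, G \in F ->
      (forall e, e \in G -> #|e| = q.+4) /\ ~ has_loose_cycle q.+2 l G) ->
  #|F| <= ((#|T|.+1 ^ c) ^ (#|B| ^ q.+3) * c ^ (#|T| ^ q.+3)) ^ d.
Proof.
move=> FP; have sF : F \subset [set decode p | p : code].
  apply/subsetP => G /FP[uG noG]; have [p <-] := decode_onto uG noG.
  exact: imset_f.
apply: leq_trans (subset_leq_card sF) _; apply: leq_trans (leq_imset_card _ _) _.
by rewrite card_ffun card_prod !card_ffun card_option !card_ord.
Qed.
End Counting.

(** Palettes have size at most [A * s ^ q.+2]; the factor [2 ^ (A * 2 ^ q.+3)] pays for choosing the
    palettes, the factor [A] for the constant in the choices within them. *)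
Definition base_const q l :=
  let A := q.+3 + l * q.+3 * q.+3 ^ q.+2 + 1 in 2 ^ (A * 2 ^ q.+3) * A.

Lemma card_divn_fiber n s (lt_blk : forall v : 'I_n, v %/ s < (n %/ s).+1) b :
  0 < s -> #|[set v : 'I_n | Ordinal (lt_blk v) == b]| <= s.
Proof.
move=> s0; rewrite -[s in _ <= s]card_ord.
pose f (v : 'I_n) : 'I_s := Ordinal (ltn_pmod v s0).
rewrite -(card_in_imset (f := f)) ?max_card // => u v; rewrite !inE.
move=> /eqP ub /eqP vb /(congr1 val) /= uv; apply: val_inj => /=.
rewrite (divn_eq u s) (divn_eq v s) uv.
by have /= -> := congr1 val (etrans ub (esym vb)).
Qed.

Lemma palette_size_le q l s : 0 < s ->
  palette_size q l s <= (q.+3 + l * q.+3 * q.+3 ^ q.+2 + 1) * s ^ q.+2.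
Proof.
move=> s0; have ss : s <= s ^ q.+2 by rewrite -[leqLHS]expn1 leq_pexp2l.
rewrite /palette_size -addn1 !mulnDl mul1n expnMn !leq_add ?expn_gt0 ?s0 //.
  by rewrite leq_mul2l ss orbT.
by rewrite mulnA.
Qed.

Lemma card_Forb_le q l n : 3 <= l -> 0 < n ->
  #|Forb q.+4 n (loose_cycle q.+4 l)| <=
    (base_const q l * (trunc_log 2 n).+1 ^ q.+2) ^ (n ^ q.+3 * (l * q.+4)).
Proof.
move=> l3 n0; set s := (trunc_log 2 n).+1; have s0 : 0 < s by [].
have lt_blk (v : 'I_n) : v %/ s < (n %/ s).+1.
  by rewrite ltnS leq_div2r // ltnW.
have ns : n < 2 ^ s by exact: trunc_log_ltn.
have sn : s <= n.
  by apply: leq_trans (trunc_logP (isT : 1 < 2) n0); apply: ltn_expl.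
have sm : s * (n %/ s).+1 <= 2 * n.
  by rewrite mulnS mul2n -addnn leq_add // mulnC leq_trunc_div.
apply: leq_trans (card_no_loose_cycle_le (q := q) l3
  (fun b => card_divn_fiber lt_blk b s0) _) _.
  move=> G; rewrite inE => /andP[/forall_inP uG noG]; split.
    by move=> e /uG /eqP.
  by move=> cyc; case/negP: noG; apply: has_loose_cycle_copy cyc; apply: leq_trans l3.
rewrite !card_ord [in leqRHS]expnM leq_exp2r ?muln_gt0 ?(leq_trans _ l3) //.
set m := (n %/ s).+1; rewrite /base_const -!/(_ + _).
have := palette_size_le q l s0; set c := palette_size q l s.
set A := q.+3 + _ + 1 => cA.
rewrite -/A -mulnA expnMn leq_mul //; last by rewrite leq_exp2r // expn_gt0 n0.
rewrite -!expnM.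
apply: leq_trans (_ : (2 ^ s) ^ (c * m ^ q.+3) <= _).
  by rewrite leq_exp2r // muln_gt0 expn_gt0.
rewrite -expnM leq_exp2l //.
(* The [s] from [n.+1 <= 2 ^ s] joins the palette bound, so that [(s * m) ^ q.+3 <= (2 * n) ^ q.+3]
   removes [s] from the exponent. *)
apply: (@leq_trans (s * (A * s ^ q.+2 * m ^ q.+3))).
  by rewrite leq_mul2l leq_mul2r cA !orbT.
rewrite -(mulnA A) mulnCA -mulnA leq_mul2l; apply/orP; right.
by rewrite mulnA -expnS -!expnMn leq_exp2r.
Qed.

(* Real logarithms and the final estimate *)
From mathcomp Require Import all_order all_algebra.
From mathcomp Require Import all_classical all_reals all_analysis.
From mathcomp Require Import ring.

Import Order.TTheory GRing.Theory Num.Theory.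

Local Open Scope classical_set_scope.
Local Open Scope ring_scope.

Lemma powR2_log2 (R : realType) (x : R) : 0 < x -> 2 `^ log2 x = x.
Proof.
move=> x0; have ln2 : ln 2 != 0 :> R by rewrite gt_eqF // ln_gt0 // ltr1n.
by rewrite /powR pnatr_eq0 /= /log2 divfK // lnK.
Qed.

Lemma ler_natpow_log2 (R : realType) a n : (0 < n)%N -> (2 ^ a <= n)%N ->
  a%:R <= log2 n%:R :> R.
Proof.
move=> n0 an; have ln2 : 0 < ln 2 :> R by rewrite ln_gt0 // ltr1n.
rewrite ler_pdivlMr // mulr_natl -lnXn ?ltr0n // ler_ln ?posrE ?ltr0n //.
by rewrite -natrX ler_nat.
Qed.

(** The base in [card_Forb_le] has order at most [L ^ (r - 2)] for [L = log2 n], hence is eventually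
    below [L ^ (2 * r)]. *)
Theorem theorem2 (R : realType) (l r : nat) (hl : (3 <= l)%N) (hr : (4 <= r)%N) :
  \forall n \near \oo,
    (#|Forb r n (loose_cycle r l)|)%:R <
      (2 : R) `^ (2 * r%:R ^+ 2 * l%:R * n%:R ^+ (r - 1) * log2 (log2 n%:R)).
Proof.
case: r hr => [|[|[|[|q]]]] // _.
(* Once [L >= a], one extra factor [L] absorbs the constant [M * 2 ^ q.+2], whose power of 2 comes
   from [s <= 2 * L]. *)
pose M := base_const q l; pose a := (M * 2 ^ q.+2).+1.
near=> n.
have an : (2 ^ a <= n)%N by near: n; exact: nbhs_infty_ge.
have n0 : (0 < n)%N by apply: leq_trans an; rewrite expn_gt0.
set L : R := log2 n%:R.
have aL : a%:R <= L by exact: ler_natpow_log2.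
have L1 : 1 <= L by apply: le_trans aL; rewrite ler1n.
have L0 : 0 < L by apply: lt_le_trans L1.
set s := (trunc_log 2 n).+1.
have sL : s%:R <= 2 * L.
  rewrite /s -natr1 mulrDl !mul1r lerD //.
  by apply: ler_natpow_log2 => //; apply: trunc_logP.
have base_lt : (M * s ^ q.+2)%:R < L ^+ (2 * q.+4).
  apply: (@lt_le_trans _ _ (L ^+ q.+3)); last first.
    by apply: ler_weXn2l => //; rewrite mul2n -addnn (leq_trans _ (leq_addr _ _)).
  apply: (@le_lt_trans _ _ ((M * 2 ^ q.+2)%:R * L ^+ q.+2)).
    rewrite !(natrM _ M) !natrX -mulrA -exprMn ler_wpM2l ?ler0n //.
    by rewrite lerXn2r ?nnegrE ?ler0n // mulr_ge0 // ltW.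
  rewrite [L ^+ q.+3]exprS ltr_pM2r ?exprn_gt0 //.
  by apply: lt_le_trans aL; rewrite ltr_nat.
set N := (n ^ q.+3 * (l * q.+4))%N.
have N0 : (0 < N)%N by rewrite muln_gt0 expn_gt0 n0 muln_gt0 (leq_trans _ hl).
(* This turns the right-hand side into [(L ^ (2 * q.+4)) ^ N], so that only the bases remain to be
   compared. *)
have -> : 2 * q.+4%:R ^+ 2 * l%:R * n%:R ^+ (q.+4 - 1) * log2 L =
    log2 L * (2 * q.+4 * N)%:R.
  rewrite subn1 [_.-1]/= -(natrX _ n) /N; move: (n ^ q.+3)%N => y; ring.
rewrite powRrM powR2_log2 // powR_mulrn ?ltW // exprM.
apply: le_lt_trans (_ : ((M * s ^ q.+2)%:R ^+ N) < _).
  by rewrite -natrX ler_nat; exact: card_Forb_le.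
by rewrite ltrXn2r ?nnegrE ?ler0n ?exprn_ge0 ?ltW // -lt0n.
Unshelve. all: by end_near.
Qed.
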